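(* Let $\mathcal G=(P,\mathcal L)$ be a partial euclidean geometry and let $\mathrm{Levi}\,\mathcal G=(P\cup\mathcal L,E)$ be its Levi graph. If $\mathcal G$ is connected and $\mathrm{mindeg}\,\mathcal G\ge2$, then: (i) $\mathrm{Levi}\,\mathcal G$ is closed; (ii) $\mathrm{Fl}\,\mathrm{Levi}\,\mathcal G=\{P\cup\mathcal L,\emptyset\}\cup\{\{x\}\mid x\in P\cup\mathcal L\}\cup\{L\mid L\in\mathcal L\}\cup\{\mathcal L(p)\mid p\in P\}$; (iii) $\mathrm{Fl}\,\mathrm{Levi}\,\mathcal G$ satisfies the Jordan–Dedekind condition.
   Context: A partial euclidean geometry (PEG) is a pair $(P,\mathcal L)$ with $P$ a finite nonempty set, $\mathcal L$ a nonempty subset of $2^P$, $P\cap 2^P=\emptyset$, such that: every point lies in some line ($P\subseteq\bigcup\mathcal L$); distinct lines $L,L'$ satisfy $|L\cap L'|\le1$; and $|L|\ge2$ for every $L\in\mathcal L$. For $p\in P$, $\mathcal L(p)$ is the set of lines containing $p$. The Levi graph $\mathrm{Levi}\,\mathcal G$ has vertex set $P\cup\mathcal L$ and edges $\{p,L\}$ for $L\in\mathcal L$, $p\in L$ (a line $L$ is thus a set of vertices of the Levi graph). $\mathrm{mindeg}\,\mathcal G$ is the minimum vertex degree of $\mathrm{Levi}\,\mathcal G$. $\mathcal G$ is connected if there is no nontrivial partition $\mathcal L=\mathcal L_1\cup\mathcal L_2$ with $(\bigcup\mathcal L_1)\cap(\bigcup\mathcal L_2)=\emptyset$. For a graph $H=(U,F)$: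 $\mathrm{St}(u)$ is the set of neighbours of $u$, $\mathrm{St}(W)=\bigcap_{w\in W}\mathrm{St}(w)$ with $\mathrm{St}(\emptyset)=U$, and $\mathrm{Fl}\,H=\{\mathrm{St}(W)\mid W\subseteq U\}$ ordered by inclusion; a vertex $u$ is closed if $\{u\}\in\mathrm{Fl}\,H$, and $H$ is closed if all its vertices are. A finite lattice satisfies the Jordan–Dedekind condition if all its maximal chains have the same length. *)

(* Defs.v *)
From HB Require Import structures.
From mathcomp Require Import all_boot all_order.

Set Implicit Arguments.
Unset Strict Implicit.
Unset Printing Implicit Defensive.

Import Order.TTheory.

Record graph := Graph {
  vertex : finType;
  adj : rel vertex;
  adj_sym : symmetric adj;
  adj_irr : irreflexive adj
}.

Section Flats.
Variable H : graph.

Definition star (u : vertex H) : {set vertex H} := [set v | adj u v].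

Definition Star (W : {set vertex H}) : {set vertex H} :=
  \bigcap_(w in W) star w.

Definition Fl : {set {set vertex H}} :=
  [set Star W | W : {set vertex H}].

Definition closed_vertex (u : vertex H) : Prop := [set u] \in Fl.

Definition closed_graph : Prop := forall u : vertex H, closed_vertex u.

(* The default #|vertex H| exceeds every degree, so that this is the genuine
   minimum as soon as H has a vertex. *)
Definition mindeg : nat := \big[minn/#|vertex H|]_(u : vertex H) #|star u|.

End Flats.

Lemma Star0 (H : graph) : Star (set0 : {set vertex H}) = [set: vertex H].
Proof. by rewrite /Star big_set0. Qed.

Lemma StarU (H : graph) (V W : {set vertex H}) :
  Star (V :|: W) = Star V :&: Star W.
Proof. exact: bigcap_setU. Qed.

Lemma Fl_setT (H : graph) : [set: vertex H] \in Fl H.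
Proof. by rewrite -Star0 imset_f. Qed.

Lemma Fl_setI (H : graph) (A B : {set vertex H}) :
  A \in Fl H -> B \in Fl H -> A :&: B \in Fl H.
Proof. by case/imsetP=> V _ -> /imsetP[W _ ->]; rewrite -StarU imset_f. Qed.

Record flat (H : graph) := Flat {
  flat_val :> {set vertex H};
  flat_in : flat_val \in Fl H
}.

Section FlatLattice.
Variable H : graph.

HB.instance Definition _ := [isSub for @flat_val H].
HB.instance Definition _ := [Finite of flat H by <:].

Implicit Types A B C : flat H.

Definition flat_le A B : bool := (A : {set vertex H}) \subset B.

Lemma flat_le_refl : reflexive flat_le.
Proof. by move=> A; apply: subxx. Qed.

Lemma flat_le_anti : antisymmetric flat_le.
Proof. by move=> A B AB; apply/val_inj/eqP; rewrite eqEsubset. Qed.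

Lemma flat_le_trans : transitive flat_le.
Proof. by move=> B A C; apply: subset_trans. Qed.

Fact flat_display : Order.disp_t. Proof. exact: Order.Disp tt tt. Qed.

HB.instance Definition _ := Order.Le_isPOrder.Build flat_display (flat H)
  flat_le_refl flat_le_anti flat_le_trans.

Definition flat_top : flat H := Flat (Fl_setT H).

Definition flat_meet A B : flat H := Flat (Fl_setI (flat_in A) (flat_in B)).

Definition flat_join A B : flat H :=
  \big[flat_meet/flat_top]_(C : flat H | flat_le A C && flat_le B C) C.

Lemma flat_meetP C A B : (C <= flat_meet A B)%O = (C <= A)%O && (C <= B)%O.
Proof. exact: subsetI. Qed.

Lemma flat_val_join A B : flat_join A B =
  \bigcap_(C : flat H | flat_le A C && flat_le B C) C :> {set vertex H}.
Proof. exact: (big_morph (@flat_val H)). Qed.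

Lemma flat_joinP A B C : (flat_join A B <= C)%O = (A <= C)%O && (B <= C)%O.
Proof.
rewrite -![(_ <= _)%O]/(flat_le _ _) /flat_le flat_val_join.
apply/idP/andP => [leC|[AC BC]]; last first.
  by apply: finset.bigcap_inf; apply/andP.
by split; apply: (subset_trans _ leC); apply/bigcapsP => D /andP[].
Qed.

HB.instance Definition _ := Order.POrder_MeetJoin_isLattice.Build
  flat_display (flat H) flat_meetP flat_joinP.

End FlatLattice.

Section JordanDedekind.
Context {d : Order.disp_t}.
Variable T : finLatticeType d.

Definition chain (C : {set T}) : bool :=
  [forall x in C, forall y in C, (x >=< y)%O].

Definition maximal_chain (C : {set T}) : bool := maxset chain C.

Definition chain_length (C : {set T}) : nat := #|C|.-1.

Definition jordan_dedekind : Prop :=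
  forall C D : {set T}, maximal_chain C -> maximal_chain D ->
    chain_length C = chain_length D.

End JordanDedekind.

Record peg := Peg {
  point : finType;
  lines : {set {set point}};
  peg_point : 0 < #|point|;
  peg_lines : lines != set0;
  peg_cover : [set: point] \subset cover lines;
  peg_inter : forall L L' : {set point},
    L \in lines -> L' \in lines -> L != L' -> #|L :&: L'| <= 1;
  peg_size : forall L : {set point}, L \in lines -> 2 <= #|L|
}.

Definition connected (G : peg) : Prop :=
  ~ exists L1 L2 : {set {set point G}},
      [/\ L1 :|: L2 = lines G, [disjoint L1 & L2], L1 != set0, L2 != set0
         & cover L1 :&: cover L2 = set0].

Definition line (G : peg) : finType := {L : {set point G} | L \in lines G}.

Section Levi.
Variable G : peg.

(* The disjoint sum stands for the union of P and L, the two being disjoint. *)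
Definition levi_adj (u v : point G + line G) : bool :=
  match u, v with
  | inl p, inr L => p \in val L
  | inr L, inl p => p \in val L
  | _, _ => false
  end.

Lemma levi_adj_sym : symmetric levi_adj.
Proof. by case=> x [y|y]. Qed.

Lemma levi_adj_irr : irreflexive levi_adj.
Proof. by case. Qed.

Definition levi : graph := Graph levi_adj_sym levi_adj_irr.

Definition line_flat (L : line G) : {set vertex levi} :=
  [set (inl p : vertex levi) | p in val L].

Definition pencil (p : point G) : {set vertex levi} :=
  [set (inr L : vertex levi) | L in [pred L : line G | p \in val L]].

End Levi.

(* Main.v *)
Require Import Defs.
From HB Require Import structures.
From mathcomp Require Import all_boot all_order.

(** By [peg_inter], the Levi graph has no 4-cycle: two distinct vertices have
    at most one common neighbour.  In any such graph of minimum degree at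
    least 2, [Star W] is everything if [W] is empty, a vertex star if [W] is a
    singleton, and has at most one element otherwise.  Conversely {x} is
    [Star [set u; v]] for any two distinct neighbours [u], [v] of [x], and the
    empty set is the Star of the whole vertex set.  No star properly contains
    another and every {x} lies in one, so the maximal chains of flats are the
    chains set0, {x}, [star u], setT with [x] adjacent to [u]. *)

Import Order.TTheory.

(** * Jordan-Dedekind condition from a rank function *)

Section RankedLattice.
Context {d : Order.disp_t} (T : finLatticeType d).
Variables (rank : T -> nat) (b t : T).
Hypothesis rank_lt : forall x y : T, (x < y)%O -> rank x < rank y.
(** Together with [rank_lt] this says that a cover raises the rank by exactly one. *)
Hypothesis rank_gap : forall x y : T, (x < y)%O -> (rank x).+1 < rank y ->
  exists2 z, (x < z)%O & (z < y)%O.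
Hypothesis ge_b : forall x, (b <= x)%O.
Hypothesis le_t : forall x, (x <= t)%O.

Lemma rank_le (x y : T) : (x <= y)%O -> rank x <= rank y.
Proof. by rewrite le_eqVlt => /predU1P[->//|/rank_lt/ltnW]. Qed.

Lemma chain_rank_le (C : {set T}) (x y : T) : chain C ->
  x \in C -> y \in C -> rank x <= rank y -> (x <= y)%O.
Proof.
move=> /forall_inP chC xC yC rxy.
have /orP[//|] := forall_inP (chC x xC) y yC.
by rewrite le_eqVlt => /predU1P[->//|/rank_lt]; rewrite ltnNge rxy.
Qed.

Lemma maximal_chain_mem (C : {set T}) (z : T) : maximal_chain C ->
  {in C, forall x, (x >=< z)%O} -> z \in C.
Proof.
case/maxsetP=> /forall_inP chC maxC cz.
have <- : z |: C = C; last exact: setU11.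
apply: maxC; last exact: subsetUr.
apply/forall_inP => x /setU1P[->|xC]; apply/forall_inP => y /setU1P[->|yC].
- exact: comparablexx.
- by rewrite comparable_sym cz.
- exact: cz.
- exact: (forall_inP (chC x xC)).
Qed.

(* If rank k were skipped, a point strictly between the C-neighbours x, y of
   the gap would be comparable to all of C. *)
Lemma maximal_chain_rank (C : {set T}) (k : nat) : maximal_chain C ->
  rank b <= k <= rank t -> exists2 x, x \in C & rank x = k.
Proof.
move=> mC /andP[bk kt].
have chC : chain C by case/maxsetP: mC.
have bC : b \in C.
  by apply: maximal_chain_mem => // x _; rewrite /Order.comparable ge_b orbT.
have tC : t \in C.
  by apply: maximal_chain_mem => // x _; rewrite /Order.comparable le_t.
have [/exists_inP[x xC /eqP]|/exists_inPn noC] :=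
  boolP [exists x in C, rank x == k]; first by exists x.
pose lo := [pred x | (x \in C) && (rank x < k)].
pose hi := [pred x | (x \in C) && (k < rank x)].
have bP : lo b by rewrite /= bC ltn_neqAle noC.
have tP : hi t.
  by rewrite /= tC ltn_neqAle kt andbT eq_sym noC.
case: (arg_maxnP rank bP) => x /andP[xC xk] maxx.
case: (arg_minnP rank tP) => y /andP[yC ky] miny.
have below w : w \in C -> rank w < k -> rank w <= rank x.
  by move=> wC wk; apply: maxx; rewrite /= wC.
have above w : w \in C -> k < rank w -> rank y <= rank w.
  by move=> wC wk; apply: miny; rewrite /= wC.
have rxy : rank x < rank y := ltn_trans xk ky.
have ltxy : (x < y)%O.
  rewrite lt_neqAle (chain_rank_le _ _ _ chC xC yC (ltnW rxy)) andbT.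
  by apply: contraTneq rxy => ->; rewrite ltnn.
have [z xz zy] := rank_gap _ _ ltxy (leq_ltn_trans xk ky).
have zC : z \in C.
  apply: maximal_chain_mem => // w wC; rewrite /Order.comparable.
  have := noC _ wC; rewrite neq_ltn => /orP[wk|kw].
    rewrite (le_trans _ (ltW xz)) //.
    exact: chain_rank_le chC wC xC (below w wC wk).
  rewrite orbC (le_trans (ltW zy)) //.
  exact: chain_rank_le chC yC wC (above w wC kw).
(* Either side of k contradicts the extremal choice of x or y, since z has rank strictly between
   theirs. *)
have := noC _ zC; rewrite neq_ltn => /orP[/(below z zC)|/(above z zC)];
  by rewrite leqNgt rank_lt.
Qed.

(** The rank is injective on a chain, and on a maximal one it takes every value from [rank b] to
    [rank t]. *)
Lemma maximal_chain_length (C : {set T}) : maximal_chain C ->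
  chain_length C = rank t - rank b.
Proof.
move=> mC; have chC : chain C by case/maxsetP: mC.
rewrite /chain_length cardE -(size_map rank).
suff /perm_size -> : perm_eq (map rank (enum C))
    (iota (rank b) (rank t - rank b).+1) by rewrite size_iota.
apply: uniq_perm; last 1 first.
- move=> k; rewrite mem_iota addnS ltnS subnKC ?rank_le //.
  apply/mapP/idP => [[x _ ->]|]; first by rewrite !rank_le.
  by case/(maximal_chain_rank _ _ mC)=> x xC <-; exists x; rewrite ?mem_enum.
- rewrite map_inj_in_uniq ?enum_uniq // => x y.
  rewrite !mem_enum => xC yC rxy; apply: le_anti.
  by rewrite !(chain_rank_le _ _ _ chC) ?rxy.
- exact: iota_uniq.
Qed.

Lemma ranked_jordan_dedekind : jordan_dedekind T.
Proof. by move=> C D mC mD; rewrite !maximal_chain_length. Qed.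

End RankedLattice.

Lemma mindeg_le (H : graph) (u : vertex H) : mindeg H <= #|star u|.
Proof.
rewrite /mindeg; have := mem_index_enum u.
elim: (index_enum _) => //= v s IHs; rewrite big_cons geq_min inE.
by case/predU1P=> [->|/IHs ->]; rewrite ?leqnn ?orbT.
Qed.

(** * Flats of a graph without 4-cycles, of minimum degree at least 2 *)

Section SquareFree.
Variable H : graph.
Implicit Types (u v x y : vertex H) (W : {set vertex H}).
Hypothesis square_free : forall u v x y,
  adj u x -> adj u y -> adj v x -> adj v y -> x != y -> u = v.
Hypothesis hdeg : 2 <= mindeg H.

Lemma StarP W x : reflect (forall w, w \in W -> adj w x) (x \in Star W).
Proof.
by apply: (iffP bigcapP) => xW w /xW; rewrite inE.
Qed.

Lemma Star1 u : Star [set u] = star u.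
Proof. exact: big_set1. Qed.

Lemma two_neighbours u : exists x y, [/\ adj u x, adj u y & x != y].
Proof.
have /card_gt1P[x [y [ux uy xy]]] := leq_trans hdeg (mindeg_le H u).
by exists x, y; rewrite !inE in ux uy.
Qed.

Lemma star_in u : star u \in Fl H.
Proof. by rewrite -Star1 imset_f. Qed.

Lemma set0_in : set0 \in Fl H.
Proof.
suff <- : Star [set: vertex H] = set0 by rewrite imset_f.
apply/setP => x; rewrite inE; apply/StarP => /(_ x (in_setT x)).
by rewrite adj_irr.
Qed.

Lemma closed_square_free : closed_graph H.
Proof.
move=> x; rewrite /closed_vertex.
have [u [v [xu xv uv]]] := two_neighbours x.
suff <- : Star [set u; v] = [set x] by apply: imset_f.
apply/setP => y; rewrite inE; apply/StarP/eqP => [yW | -> w].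
  apply: (square_free _ _ u v) => //; rewrite adj_sym yW // !inE eqxx //.
  by rewrite orbT.
by rewrite !inE adj_sym => /orP[] /eqP->.
Qed.

(** Two distinct elements of W with two distinct common neighbours would form a 4-cycle, so W is
    empty or a singleton. *)
Lemma Fl_gt1 (A : {set vertex H}) : A \in Fl H -> 1 < #|A| ->
  A = setT \/ exists u, A = star u.
Proof.
case/imsetP=> W _ -> /card_gt1P[x [y [/StarP xW /StarP yW xy]]].
have [->|[u uW]] := set_0Vmem W; first by left; rewrite Star0.
right; exists u; rewrite -Star1; congr Star.
apply/setP => v; rewrite inE; apply/idP/eqP => [vW|-> //].
by apply: (square_free _ _ x y); rewrite ?xW ?yW.
Qed.

Lemma Fl_square_free : Fl H =
  [set [set: vertex H]; set0] :|: [set [set x] | x : vertex H]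
    :|: [set star u | u : vertex H].
Proof.
apply/setP => A; rewrite !inE; apply/idP/idP => [AF|].
  have [A1|] := ltnP 1 #|A|.
    case: (Fl_gt1 _ AF A1) => [->|[u ->]]; first by rewrite eqxx.
    by rewrite imset_f ?orbT.
  rewrite leq_eqVlt ltnS leqn0 cards_eq0 => /orP[/cards1P[x ->]|->].
    by rewrite imset_f ?orbT.
  by rewrite orbT.
case/orP => [/orP[/orP[]/eqP-> | /imsetP[x _ ->]] | /imsetP[u _ ->]].
- exact: Fl_setT.
- exact: set0_in.
- exact: closed_square_free.
- exact: star_in.
Qed.

(** Under the section hypotheses the rank is 0 on the empty set, 1 on singletons, 2 on vertex stars
    and 3 on the whole vertex set. *)
Definition flat_rank (A : flat H) : nat :=
  (0 < #|flat_val A|) + (1 < #|flat_val A|) + (flat_val A == setT).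

Lemma flat_ltE (A B : flat H) :
  (A < B)%O = (flat_val A \proper flat_val B).
Proof. by rewrite lt_leAnge. Qed.

Lemma flat_rank_lt (A B : flat H) : (A < B)%O -> flat_rank A < flat_rank B.
Proof.
rewrite flat_ltE => AB; have cAB := proper_card AB.
have nAT : flat_val A == setT = false.
  apply: contraTF AB => /eqP ->; rewrite properE subsetT /=.
  by apply/negP => /andP[].
rewrite /flat_rank nAT addn0.
(* If A has at most one element, the growth in cardinality alone raises the rank. *)
have [A1|] := ltnP 1 #|flat_val A|; last first.
  case: (#|flat_val A|) cAB => [|[]//]; first by case: (#|flat_val B|).
  by move=> cB; rewrite cB (ltnW cB).
have B1 := ltn_trans A1 cAB; rewrite (ltnW A1) B1 (ltnW B1).
suff -> : flat_val B = setT by rewrite eqxx.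
case: (Fl_gt1 _ (flat_in B) B1) => // -[v Bv].
case: (Fl_gt1 _ (flat_in A) A1) => [/eqP|[u Au]]; first by rewrite nAT.
case/properP: AB => /subsetP sAB [w]; rewrite Au Bv => wv /negP[].
(* If [star u] lies in [star v], two neighbours of u are common to u and v, which forces u = v. *)
have [x [y [ux uy xy]]] := two_neighbours u.
suff -> : u = v by [].
have sub z : adj u z -> adj v z.
  by move=> uz; have := sAB z; rewrite Au Bv !inE; apply.
by apply: (square_free _ _ x y) => //; apply: sub.
Qed.

Lemma flat_rank_gap (A B : flat H) : (A < B)%O ->
  (flat_rank A).+1 < flat_rank B -> exists2 C : flat H, (A < C)%O & (C < B)%O.
Proof.
move=> AB rAB; have := AB; rewrite flat_ltE => pAB.
(* Above the empty flat, a singleton inside B fills the gap, as B has at least two elements. *)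
have [A0|A0] := posnP #|flat_val A|.
  have /properP[_ [v vB _]] := pAB.
  have B1 : 1 < #|flat_val B|.
    have [/eqP BT|nBT] := boolP (flat_val B == setT).
      have [x [y [_ _ xy]]] := two_neighbours v.
      by apply/card_gt1P; exists x, y; rewrite BT !inE.
    move: rAB; rewrite /flat_rank (negPf nBT) A0.
    by case: (0 < #|flat_val B|); case: (1 < #|flat_val B|); case: (_ == _).
  exists (Flat (closed_square_free v)); rewrite flat_ltE /=.
    by rewrite (cards0_eq A0) proper0 -card_gt0 cards1.
  by rewrite properEcard sub1set vB cards1.
move: rAB; rewrite /flat_rank A0.
case: eqP => [AT|_].
  by move: pAB; rewrite AT properE subsetT subTset andbC; case: eqP.
(* Here A has rank 2, and no flat has rank above 3, so there is no gap. *)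
have [A1|A1] := ltnP 1 #|flat_val A|.
  by case: (0 < _); case: (1 < _); case: (_ == _).
case: (flat_val B =P setT) => [BT _|_]; last by case: (0 < _); case: (1 < _).
have /cards1P[v Av] : #|flat_val A| == 1 by rewrite eqn_leq A1 A0.
(* Between {v} and the whole vertex set lies the star of any neighbour u of v: it has a second
   element and misses u. *)
have [u [_ [vu _ _]]] := two_neighbours v.
exists (Flat (star_in u)); rewrite flat_ltE /=.
  have [x [y [ux uy xy]]] := two_neighbours u.
  rewrite Av properEcard sub1set inE adj_sym vu cards1 /=.
  by apply/card_gt1P; exists x, y; rewrite !inE.
by rewrite BT properT; apply/eqP => /setP/(_ u); rewrite !inE adj_irr.
Qed.

Lemma jordan_dedekind_square_free : jordan_dedekind (flat H).
Proof.
apply: (ranked_jordan_dedekind _ flat_rank (Flat set0_in) (flat_top H)).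
- exact: flat_rank_lt.
- exact: flat_rank_gap.
- by move=> A; apply: sub0set.
- by move=> A; apply: subsetT.
Qed.

End SquareFree.

(** * Application to Levi graphs *)

Lemma levi_square_free (G : peg) (u v x y : vertex (levi G)) :
  adj u x -> adj u y -> adj v x -> adj v y -> x != y -> u = v.
Proof.
have common (L L' : line G) (p q : point G) :
    p \in val L -> q \in val L -> p \in val L' -> q \in val L' ->
    p != q -> L = L'.
  move=> pL qL pL' qL' pq; apply/val_inj/eqP/contraT => LL'.
  have := peg_inter (valP L) (valP L') LL'; rewrite leqNgt => /negP[].
  by apply/card_gt1P; exists p, q; rewrite !inE pL pL' qL qL'.
(* Bipartiteness leaves two cases: u, v are points on the distinct lines x, y, or u, v are lines
   through the distinct points x, y. *)
case: u v x y => [p|L] [q|L'] [r|M] [s|M'] //= ux uy vx vy xy.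
  have [-> //|pq] := eqVneq p q; case/eqP: xy; congr inr.
  exact: common pq.
by congr inr; apply: (common _ _ r s).
Qed.

Lemma star_inl (G : peg) (p : point G) : @star (levi G) (inl p) = pencil p.
Proof.
apply/setP => -[q|L]; rewrite !inE /=; first by apply/esym/imsetP => -[].
by rewrite mem_imset ?inE // => ? ? [].
Qed.

Lemma star_inr (G : peg) (L : line G) : @star (levi G) (inr L) = line_flat L.
Proof.
apply/setP => -[q|M]; rewrite !inE /=; last by apply/esym/imsetP => -[].
by rewrite mem_imset // => ? ? [].
Qed.

Lemma stars_levi (G : peg) : [set star u | u : vertex (levi G)] =
  [set line_flat L | L : line G] :|: [set pencil p | p : point G].
Proof.
apply/setP => A; rewrite !inE; apply/imsetP/orP.
  case=> -[p|L] _ ->; first by right; rewrite star_inl imset_f.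
  by left; rewrite star_inr imset_f.
case=> /imsetP[x _ ->]; first by exists (inr x); rewrite ?star_inr.
by exists (inl x); rewrite ?star_inl.
Qed.

Theorem theorem6p13 (G : peg) (hconn : connected G)
    (hdeg : 2 <= mindeg (levi G)) :
  [/\ closed_graph (levi G),
      Fl (levi G) =
        [set [set: vertex (levi G)]; set0]
        :|: [set [set x] | x : vertex (levi G)]
        :|: [set line_flat L | L : line G]
        :|: [set pencil p | p : point G]
    & jordan_dedekind (flat (levi G))].
Proof.
have sqf := @levi_square_free G; split.
- exact: closed_square_free.
- by rewrite Fl_square_free // stars_levi setUA.
- exact: jordan_dedekind_square_free.
Qed.
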